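(* INF proves that the Church counting axiom, $\forall j\in\mathbb{N}\,(j\,\mathsf{S}\,\mathbf{0}=j)$, implies that the set $\mathbb{N}$ of Church numbers is not finite.
   Context: INF (intuitionistic New Foundations) is the first-order theory with equality over intuitionistic logic, with one binary predicate $\in$, whose axioms are extensionality ($\forall z(z\in x\leftrightarrow z\in y)\to x=y$) and stratified comprehension (the set $\{x:\varphi\}$ exists for every stratified $\varphi$, parameters allowed; $\varphi$ is stratified if its variables can be assigned natural-number indices so that in each subformula $x\in y$ the index of $y$ is one more than that of $x$, and in each $x=y$ the indices agree). Ordered pairs are $\langle x,y\rangle=\{\{x\},\{x,y\}\}$. $\mathrm{FUNC}=\{f:\forall x,y,z(\langle x,y\rangle\in f\to\langle x,z\rangle\in f\to y=z)\}$. Application: $Ap(f,x)=\{t:\exists y(\langle x,y\rangle\in f\land t\in y)\}$, so $Ap(f,x)=y$ if $f\in\mathrm{FUNC}$ and $\langle x,y\rangle\in f$. Write $fx$ for $Ap(f,x)$, associating to the left; so $j\,\mathsf{S}\,\mathbf{0}$ means $Ap(Ap(j,\mathsf{S}),\mathbf{0})$. Church numbers: $\mathbf{0}=\{\langle f,\mathrm{id}\rangle: f=f\}$ with $\mathrm{id}=\{\langle x,x\rangle:x=x\}$. Church successor is the set of all pairs $\langle z,s_z\rangle$ with $z\in\mathrm{FUNC}$, where $s_z$ is the set of all $\langle f,p\rangle$ with $f\in\mathrm{FUNC}$ and $\forall u\,(u\in p\leftrightarrow\exists x,w,t,q\,(u=\langle x,w\rangle\land t\in\mathrm{FUNC}\land\langle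 f,t\rangle\in z\land\langle x,q\rangle\in t\land\langle q,w\rangle\in f))$; it is denoted $\mathsf{S}$. $\mathbb{N}$ is the intersection of all sets containing $\mathbf{0}$ and closed under $\mathsf{S}$. A set is finite if it belongs to $\mathrm{FINITE}$, the intersection of all sets $w$ with $\emptyset\in w$ and $\forall x,c\,(x\in w\land c\notin x\to x\cup\{c\}\in w)$. *)

(* Defs.v *)
From Stdlib Require Import List.
Import ListNotations.

(** First-order formulas over [∈] and [=], with de Bruijn indices.  There are no
    function symbols, so the terms are the variables and substitution is renaming. *)
Inductive form : Type :=
| Bot
| Mem (x y : nat)
| Eq (x y : nat)
| And (p q : form)
| Or (p q : form)
| Imp (p q : form)
| All (p : form)
| Ex (p : form).

Definition Iff (p q : form) : form := And (Imp p q) (Imp q p).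

Definition scons {A : Type} (a : A) (s : nat -> A) (n : nat) : A :=
  match n with 0 => a | S m => s m end.

Definition up (r : nat -> nat) : nat -> nat := scons 0 (fun n => S (r n)).

Fixpoint ren (r : nat -> nat) (p : form) : form :=
  match p with
  | Bot => Bot
  | Mem x y => Mem (r x) (r y)
  | Eq x y => Eq (r x) (r y)
  | And p q => And (ren r p) (ren r q)
  | Or p q => Or (ren r p) (ren r q)
  | Imp p q => Imp (ren r p) (ren r q)
  | All p => All (ren (up r) p)
  | Ex p => Ex (ren (up r) p)
  end.

Definition shift : form -> form := ren S.
Definition inst (y : nat) : form -> form := ren (scons y (fun n => n)).

(** Intuitionistic natural deduction with equality.  By [prv_ax] the axioms in [T]
    hold in every context, so their free variables can be generalised by [prv_allI]:
    an open axiom stands for its universal closure. *)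
Inductive prv (T : form -> Prop) : list form -> form -> Prop :=
| prv_ax G p : T p -> prv T G p
| prv_hyp G p : In p G -> prv T G p
| prv_botE G p : prv T G Bot -> prv T G p
| prv_andI G p q : prv T G p -> prv T G q -> prv T G (And p q)
| prv_andE1 G p q : prv T G (And p q) -> prv T G p
| prv_andE2 G p q : prv T G (And p q) -> prv T G q
| prv_orI1 G p q : prv T G p -> prv T G (Or p q)
| prv_orI2 G p q : prv T G q -> prv T G (Or p q)
| prv_orE G p q r :
    prv T G (Or p q) -> prv T (p :: G) r -> prv T (q :: G) r -> prv T G r
| prv_impI G p q : prv T (p :: G) q -> prv T G (Imp p q)
| prv_impE G p q : prv T G (Imp p q) -> prv T G p -> prv T G q
| prv_allI G p : prv T (map shift G) p -> prv T G (All p)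
| prv_allE G p y : prv T G (All p) -> prv T G (inst y p)
| prv_exI G p y : prv T G (inst y p) -> prv T G (Ex p)
| prv_exE G p q :
    prv T G (Ex p) -> prv T (p :: map shift G) (shift q) -> prv T G q
| prv_eqI G x : prv T G (Eq x x)
| prv_eqE G p x y : prv T G (Eq x y) -> prv T G (inst x p) -> prv T G (inst y p).

Definition proves (T : form -> Prop) (p : form) : Prop := prv T [] p.

(** [s] indexes the free variables; each quantifier picks an index for the
    variable it binds. *)
Fixpoint stratified_by (s : nat -> nat) (p : form) : Prop :=
  match p with
  | Bot => True
  | Mem x y => s y = S (s x)
  | Eq x y => s x = s y
  | And p q | Or p q | Imp p q => stratified_by s p /\ stratified_by s q
  | All p | Ex p => exists i, stratified_by (scons i s) p
  end.

Definition stratified (p : form) : Prop := exists s, stratified_by s p.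

Inductive INF : form -> Prop :=
| INF_extensionality :
    INF (All (All (Imp (All (Iff (Mem 0 1) (Mem 0 2))) (Eq 0 1))))
(** The set variable is bound outside [x = 0] and is not free in [p], so the
    parameters of [p] are shifted past it. *)
| INF_comprehension p :
    stratified p -> INF (Ex (All (Iff (Mem 0 1) (ren (up S) p)))).

(** A formula in a context of [n] variables, as a function of [n].  Variables are
    referred to by de Bruijn levels, which do not change under binders, so formulas
    can be written with Rocq binders. *)
Definition sform : Type := nat -> form.

Definition index (n l : nat) : nat := n - S l.

(** A term is represented by the contextual elimination of it: [t k] says that [k]
    holds of the value of [t]. *)
Definition term : Type := (nat -> sform) -> sform.

Definition var (l : nat) : term := fun k => k l.

(** [k {x : f x}] stands for [∃a (∀x (x ∈ a <-> f x) ∧ k a)]. *)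
Definition abstract (f : term -> sform) : term := fun k n =>
  Ex (And (All (Iff (Mem 0 1) (f (var (S n)) (S (S n))))) (k n (S n))).

(** Defined operations are specified on variables: [value x = t in F] names
    the value of the argument [t] before [F] is expanded, so that [t] is not copied. *)
Definition bind (t : term) (F : term -> term) : term :=
  fun k => t (fun a => F (var a) k).

Definition smem (t u : term) : sform :=
  t (fun a => u (fun b n => Mem (index n a) (index n b))).
Definition sequal (t u : term) : sform :=
  t (fun a => u (fun b n => Eq (index n a) (index n b))).
Definition sbot : sform := fun _ => Bot.
Definition sand (p q : sform) : sform := fun n => And (p n) (q n).
Definition sor (p q : sform) : sform := fun n => Or (p n) (q n).
Definition simp (p q : sform) : sform := fun n => Imp (p n) (q n).
Definition siff (p q : sform) : sform := fun n => Iff (p n) (q n).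
Definition sneg (p : sform) : sform := simp p sbot.
Definition sall (f : term -> sform) : sform := fun n => All (f (var n) (S n)).
Definition sex (f : term -> sform) : sform := fun n => Ex (f (var n) (S n)).

Definition sentence (p : sform) : form := p 0.

Declare Scope inf_scope.
Delimit Scope inf_scope with inf.
Bind Scope inf_scope with sform.

Notation "t ∈ u" := (smem t u) (at level 70, no associativity) : inf_scope.
Notation "t ≐ u" := (sequal t u) (at level 70, no associativity) : inf_scope.
Notation "¬ p" := (sneg p) (at level 75, right associativity) : inf_scope.
Notation "p ∧ q" := (sand p q) (at level 80, right associativity) : inf_scope.
Notation "p ∨ q" := (sor p q) (at level 85, right associativity) : inf_scope.
Notation "p ⟷ q" := (siff p q) (at level 95, no associativity) : inf_scope.
Notation "p ⟶ q" := (simp p q) (at level 99, right associativity) : inf_scope.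
Notation "∀ x .. y , p" := (sall (fun x => .. (sall (fun y => p)) ..))
  (at level 200, x binder, y binder, right associativity) : inf_scope.
Notation "∃ x .. y , p" := (sex (fun x => .. (sex (fun y => p)) ..))
  (at level 200, x binder, y binder, right associativity) : inf_scope.
Notation "⦃ x | p ⦄" := (abstract (fun x => p))
  (at level 0, x name, p at level 200) : inf_scope.
Notation "'value' x = t 'in' F" := (bind t (fun x => F))
  (at level 200, x name, t at level 69, F at level 200, right associativity) : inf_scope.
Open Scope inf_scope.

Definition empty : term := ⦃ x | sbot ⦄.
Definition singleton (s : term) : term := value x = s in ⦃ u | u ≐ x ⦄.
Definition upair (s t : term) : term :=
  value x = s in value y = t in ⦃ u | u ≐ x ∨ u ≐ y ⦄.
Definition opair (s t : term) : term :=
  value x = s in value y = t in upair (singleton x) (upair x y).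
Definition union (s t : term) : term :=
  value x = s in value y = t in ⦃ u | u ∈ x ∨ u ∈ y ⦄.

Definition FUNC : term :=
  ⦃ f | ∀ x y z, opair x y ∈ f ⟶ opair x z ∈ f ⟶ y ≐ z ⦄.

Definition Ap (r s : term) : term :=
  value f = r in value x = s in ⦃ t | ∃ y, opair x y ∈ f ∧ t ∈ y ⦄.

Definition id_fun : term := ⦃ u | ∃ x, x ≐ x ∧ u ≐ opair x x ⦄.

Definition zero : term := ⦃ u | ∃ f, f ≐ f ∧ u ≐ opair f id_fun ⦄.

Definition succ_of (r : term) : term :=
  value z = r in
  ⦃ v | ∃ f p, v ≐ opair f p ∧ f ∈ FUNC ∧
        ∀ u, u ∈ p ⟷
             ∃ x w t q, u ≐ opair x w ∧ t ∈ FUNC ∧ opair f t ∈ z ∧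
                        opair x q ∈ t ∧ opair q w ∈ f ⦄.

Definition succ : term := ⦃ v | ∃ z, z ∈ FUNC ∧ v ≐ opair z (succ_of z) ⦄.

Definition NN : term :=
  ⦃ n | ∀ w, zero ∈ w ∧ (∀ x, x ∈ w ⟶ Ap succ x ∈ w) ⟶ n ∈ w ⦄.

Definition FINITE : term :=
  ⦃ y | ∀ w, empty ∈ w ∧
             (∀ x c, x ∈ w ∧ ¬ c ∈ x ⟶ union x (singleton c) ∈ w) ⟶ y ∈ w ⦄.

Definition church_counting : sform := ∀ j, j ∈ NN ⟶ Ap (Ap j succ) zero ≐ j.

(* Main.v *)
(** Provability is turned into truth in the Heyting-valued model whose individuals are the
    variables and whose truth values are closed sets of contexts, where set-theoretic
    arguments can be carried out with Rocq binders.

    Suppose [N] is finite.  The empty set [c] is not a Church number.  By induction on the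
    finite set [X], for every [c ∉ X] there is a partial function [f] whose orbit from [c]
    contains [X ∪ {c}]: to add [d] to [X], extend the function for [d ∉ X] by [⟨c,d⟩].  Take
    [X = N] and let [W] be the set of the pairs [⟨j S 0, j f c⟩] with [j ∈ N].  This is
    stratified, because [S] and [f] act on objects of the same index.  By the counting axiom
    [j S 0 = j], so that [⟨n,y⟩ ∈ W] implies [y = n f c]; hence [W] is a function on [N], and
    it takes every value in [N ∪ {c}].  The pigeonhole principle, whose conclusion is
    absurdity and which therefore needs no decidable equality, refutes this. *)

From Stdlib Require Import List Lia PeanoNat.
Require Import Defs.
Import ListNotations.

(** * Renaming and weakening *)

Lemma up_ext r r' : (forall n, r n = r' n) -> forall n, up r n = up r' n.
Proof. intros H [|n]; simpl; auto. Qed.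

Lemma ren_ext p : forall r r', (forall n, r n = r' n) -> ren r p = ren r' p.
Proof.
  induction p; intros r r' H; simpl; f_equal; auto using up_ext.
Qed.

Lemma ren_ren p : forall r r', ren r (ren r' p) = ren (fun n => r (r' n)) p.
Proof.
  induction p; intros r r'; simpl; f_equal; auto; rewrite IHp;
    apply ren_ext; intros [|n]; reflexivity.
Qed.

Lemma ren_id p : forall r, (forall n, r n = n) -> ren r p = p.
Proof.
  induction p; intros r H; simpl; f_equal; auto; apply IHp;
    intros [|n]; simpl; auto.
Qed.

Fixpoint fv_bound (p : form) : nat :=
  match p with
  | Bot => 0
  | Mem x y | Eq x y => S (Nat.max x y)
  | And p q | Or p q | Imp p q => Nat.max (fv_bound p) (fv_bound q)
  | All p | Ex p => pred (fv_bound p)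
  end.

Lemma ren_ext_below p : forall r r',
  (forall n, n < fv_bound p -> r n = r' n) -> ren r p = ren r' p.
Proof.
  induction p; intros r r' H; simpl in *; f_equal;
    try (apply H; lia);
    try (apply IHp1; intros; apply H; lia);
    try (apply IHp2; intros; apply H; lia);
    try (apply IHp; intros [|n] Hn; simpl; auto; f_equal; apply H; lia).
  reflexivity.
Qed.

Lemma ren_inst r y p : ren r (inst y p) = inst (r y) (ren (up r) p).
Proof.
  unfold inst. rewrite !ren_ren. apply ren_ext. intros [|n]; reflexivity.
Qed.

Lemma ren_shift r p : ren (up r) (shift p) = shift (ren r p).
Proof. unfold shift. rewrite !ren_ren. reflexivity. Qed.

Lemma map_ren_shift r G :
  map (ren (up r)) (map shift G) = map shift (map (ren r) G).
Proof.
  rewrite !map_map. apply map_ext. intros p. apply ren_shift.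
Qed.

Lemma prv_incl T G G' p : prv T G p -> incl G G' -> prv T G' p.
Proof.
  intros H. revert G'. induction H; intros G' HG.
  - now apply prv_ax.
  - apply prv_hyp; auto.
  - apply prv_botE; auto.
  - apply prv_andI; auto.
  - eapply prv_andE1; eauto.
  - eapply prv_andE2; eauto.
  - apply prv_orI1; auto.
  - apply prv_orI2; auto.
  - eapply prv_orE; eauto; [apply IHprv2 | apply IHprv3];
      now apply incl_cons; [left | apply incl_tl].
  - apply prv_impI, IHprv. now apply incl_cons; [left | apply incl_tl].
  - eapply prv_impE; eauto.
  - apply prv_allI, IHprv. now apply incl_map.
  - apply prv_allE; auto.
  - eapply prv_exI; eauto.
  - eapply prv_exE; eauto. apply IHprv2.
    apply incl_cons; [now left|]. now apply incl_tl, incl_map.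
  - apply prv_eqI.
  - eapply prv_eqE; eauto.
Qed.

(** A renaming that identifies variables could force two different indices to agree. The left
    inverse [r'] excludes this and supplies the new assignment: each variable takes the index of its
    preimage. *)
Lemma stratified_by_ren p : forall s r r', (forall n, r' (r n) = n) ->
  stratified_by s p -> stratified_by (fun n => s (r' n)) (ren r p).
Proof.
  assert (ext : forall p s s', (forall n, s n = s' n) ->
                  stratified_by s p -> stratified_by s' p).
  { clear. induction p; intros s s' E; simpl; rewrite <- ?E; auto.
    1-3: intros [H1 H2]; split; eauto.
    1-2: intros [i H]; exists i; revert H; apply IHp; intros [|n]; simpl; auto. }
  induction p; intros s r r' E; simpl; rewrite ?E; auto.
  1-3: intros [H1 H2]; split; eauto.
  1-2: intros [i H]; exists i;
    apply (ext _ (fun n => scons i s (up r' n)));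
    [ intros [|n]; reflexivity
    | apply IHp; auto; intros [|n]; simpl; auto ].
Qed.

(** Only renamings with a left inverse preserve stratification, hence the axioms. *)
Lemma INF_ren p r r' : (forall n, r' (r n) = n) -> INF p -> INF (ren r p).
Proof.
  intros E [|q [s Hs]].
  - exact INF_extensionality.
  - replace (ren r _) with (Ex (All (Iff (Mem 0 1) (ren (up S) (ren (up r) q))))).
    + apply INF_comprehension. exists (fun n => s (up r' n)).
      apply stratified_by_ren; auto. intros [|n]; simpl; auto.
    + simpl. unfold Iff. rewrite !ren_ren.
      repeat (f_equal; try (apply ren_ext; intros [|n]; reflexivity)).
Qed.

(** The left inverse serves the axiom case through [INF_ren]. It survives the passage under a
    binder, where it becomes [up f']. *)
Lemma prv_ren G p : prv INF G p -> forall r r', (forall n, r' (r n) = n) ->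
  prv INF (map (ren r) G) (ren r p).
Proof.
  intros Hp; induction Hp; intros f f' E; simpl in *.
  - apply prv_ax. eapply INF_ren; eauto.
  - apply prv_hyp. now apply in_map.
  - apply prv_botE; eauto.
  - apply prv_andI; eauto.
  - eapply prv_andE1; eauto.
  - eapply prv_andE2; eauto.
  - apply prv_orI1; eauto.
  - apply prv_orI2; eauto.
  - eapply prv_orE; eauto.
  - apply prv_impI; eauto.
  - eapply prv_impE; eauto.
  - apply prv_allI. rewrite <- map_ren_shift. apply (IHHp _ (up f')).
    intros [|n]; simpl; auto.
  - rewrite ren_inst. apply prv_allE. eauto.
  - apply (prv_exI _ _ _ (f y)). rewrite <- ren_inst. eauto.
  - eapply prv_exE; eauto. rewrite <- map_ren_shift, <- ren_shift.
    apply (IHHp2 _ (up f')). intros [|n]; simpl; auto.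
  - apply prv_eqI.
  - rewrite ren_inst. eapply prv_eqE; eauto. rewrite <- ren_inst. eauto.
Qed.

(** Arbitrary substitution instances are reached by generalising and instantiating. *)
Lemma prv_nil_subst p : prv INF [] p -> forall e, prv INF [] (ren e p).
Proof.
  (* The first [k] variables are bound one after the other by [prv_allI] and then instantiated with
     their values under [e]. The variables above them drop by [k] in the process, which is why
     [e (k + n) = n] is required. *)
  assert (K : forall k q e, prv INF [] q -> (forall n, e (k + n) = n) ->
                prv INF [] (ren e q)).
  { induction k; intros q e Hq He.
    - now rewrite ren_id.
    - specialize (IHk (All q) (fun n => e (S n))). simpl in IHk.
      apply prv_allE with (y := e 0) in IHk.
      + unfold inst in IHk. rewrite ren_ren in IHk.
        erewrite ren_ext; [exact IHk|]. intros [|n]; reflexivity.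
      + now apply prv_allI.
      + exact He. }
  intros Hp e.
  (* Above the free variables of [p], [e] may be replaced by subtraction of [fv_bound p], which
     gives it the shape that [K] demands. *)
  rewrite (ren_ext_below p e
    (fun n => if n <? fv_bound p then e n else n - fv_bound p)).
  - apply (K (fv_bound p)); auto. intros n.
    destruct (Nat.ltb_spec (fv_bound p + n) (fv_bound p)); lia.
  - intros n Hn. destruct (Nat.ltb_spec n (fv_bound p)); lia.
Qed.

(** An injective renaming that turns the named variable [y] into the eigenvariable 0 of the
    quantifier rules. On formulas in which [y] is fresh it acts as [shift]. *)
Definition to_front (y n : nat) : nat := if n =? y then 0 else S n.

Lemma ren_to_front y p : fv_bound p <= y -> ren (to_front y) p = shift p.
Proof.
  intros H. apply ren_ext_below. intros n Hn. unfold to_front.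
  destruct (Nat.eqb_spec n y); lia.
Qed.

Lemma ren_to_front_inst y p :
  fv_bound p <= y -> ren (to_front y) (inst y p) = p.
Proof.
  intros H. unfold inst. rewrite ren_ren.
  transitivity (ren (fun n => n) p); [|now apply ren_id].
  apply ren_ext_below. intros [|n] Hn; simpl; unfold to_front.
  - now rewrite Nat.eqb_refl.
  - destruct (Nat.eqb_spec n y); lia.
Qed.

Lemma prv_to_front y G p :
  prv INF G p -> prv INF (map (ren (to_front y)) G) (ren (to_front y) p).
Proof.
  intros H. apply (prv_ren G p H _ (scons y (fun n => n))).
  intros n. unfold to_front. destruct (Nat.eqb_spec n y); simpl; auto.
Qed.

Lemma map_to_front G : exists b, forall y, b <= y ->
  map (ren (to_front y)) G = map shift G.
Proof.
  induction G as [|p G [b Hb]].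
  - now exists 0.
  - exists (Nat.max b (fv_bound p)). intros y Hy. simpl.
    rewrite Hb, ren_to_front by lia. reflexivity.
Qed.

(** The premise is used at a single [y] beyond all free variables of [G] and [p], which [to_front]
    then makes the eigenvariable. Quantifying over [y] in the premise allows Rocq binders to stand
    for object variables. *)
Lemma prv_allI_inst G p :
  (forall y, prv INF G (inst y p)) -> prv INF G (All p).
Proof.
  intros H. destruct (map_to_front G) as [b Hb].
  set (y := Nat.max b (fv_bound p)).
  apply prv_allI. rewrite <- (Hb y) by lia.
  rewrite <- (ren_to_front_inst y p) by lia. apply prv_to_front, H.
Qed.

Lemma prv_exE_inst G p q : prv INF G (Ex p) ->
  (forall y, prv INF (inst y p :: G) q) -> prv INF G q.
Proof.
  intros He H. destruct (map_to_front G) as [b Hb].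
  set (y := Nat.max b (Nat.max (fv_bound p) (fv_bound q))).
  apply (prv_exE _ _ _ _ He).
  rewrite <- (Hb y), <- (ren_to_front y q), <- (ren_to_front_inst y p) at 1 by lia.
  apply (prv_to_front y (_ :: _)), H.
Qed.

(** * Heyting-valued semantics *)

(** The truth values are the sets of contexts that are intersections of sets of the form
    [{G | G, G0 ⊢ q}], and the individuals are the variables themselves. *)
Record truth : Type := Truth {
  holds :> list form -> Prop;
  holds_incl : forall G G', incl G G' -> holds G -> holds G';
  holds_closed : forall G,
    (forall q G', incl G G' ->
      (forall G'', incl G' G'' -> holds G'' -> prv INF G'' q) -> prv INF G' q) ->
    holds G }.

Declare Scope truth_scope.
Delimit Scope truth_scope with truth.
Bind Scope truth_scope with truth.
Notation "G ⊩ P" := (holds P%truth G) (at level 100, P at level 200).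

Definition D : Type := nat.

#[local] Hint Resolve incl_refl incl_tran incl_tl incl_cons in_eq : core.

Program Definition provable (p : form) : truth := Truth (fun G => prv INF G p) _ _.
Next Obligation. eapply prv_incl; eauto. Qed.

Definition hbot : truth := provable Bot.
Definition hmem (x y : D) : truth := provable (Mem x y).
Definition heq (x y : D) : truth := provable (Eq x y).

Program Definition hand (P Q : truth) : truth := Truth (fun G => P G /\ Q G) _ _.
Next Obligation. split; eapply holds_incl; eauto. Qed.
Next Obligation.
  split; apply holds_closed; intros q G' HG K; apply H; auto;
    intros G'' HG' [? ?]; auto.
Qed.

Program Definition himp (P Q : truth) : truth :=
  Truth (fun G => forall G', incl G G' -> P G' -> Q G') _ _.
Next Obligation. eauto. Qed.
Next Obligation.
  apply holds_closed. intros q G'' HG K. apply H; eauto.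
  intros G1 HG1 HPQ. apply K; auto. apply HPQ; auto.
  eapply holds_incl; [|eassumption]; eauto.
Qed.

Program Definition hall (P : D -> truth) : truth :=
  Truth (fun G => forall x, P x G) _ _.
Next Obligation. eapply holds_incl; eauto. Qed.
Next Obligation.
  apply holds_closed. intros q G' HG K. apply H; auto.
Qed.

(** The union of the values [P x] need not be closed. Its closure is described by elimination:
    whatever formula follows from every [P x] in all larger contexts is already provable. [hor]
    below follows the same pattern. *)
Program Definition hex (P : D -> truth) : truth :=
  Truth (fun G => forall q G', incl G G' ->
    (forall x G'', incl G' G'' -> P x G'' -> prv INF G'' q) -> prv INF G' q) _ _.
Next Obligation. eauto. Qed.
Next Obligation. apply H; auto. intros G1 HG HE. apply HE; eauto. Qed.

Program Definition hor (P Q : truth) : truth :=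
  Truth (fun G => forall q G', incl G G' ->
    (forall G'', incl G' G'' -> P G'' -> prv INF G'' q) ->
    (forall G'', incl G' G'' -> Q G'' -> prv INF G'' q) -> prv INF G' q) _ _.
Next Obligation. eauto. Qed.
Next Obligation. apply H; auto. intros G1 HG HE. apply HE; eauto. Qed.

Definition hiff (P Q : truth) : truth := hand (himp P Q) (himp Q P).

Fixpoint tr (e : nat -> D) (p : form) : truth :=
  match p with
  | Bot => hbot
  | Mem x y => hmem (e x) (e y)
  | Eq x y => heq (e x) (e y)
  | And p q => hand (tr e p) (tr e q)
  | Or p q => hor (tr e p) (tr e q)
  | Imp p q => himp (tr e p) (tr e q)
  | All p => hall (fun x => tr (scons x e) p)
  | Ex p => hex (fun x => tr (scons x e) p)
  end.

Lemma inst_up e x p : inst x (ren (up e) p) = ren (scons x e) p.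
Proof.
  unfold inst. rewrite ren_ren. apply ren_ext. intros [|n]; reflexivity.
Qed.

(** Truth in the model is exactly provability. For disjunction and existence, truth gives
    provability by taking the renamed formula itself as the conclusion [q]; for the quantifiers, the
    rules with arbitrary instances match the individuals being variables. *)
Theorem tr_prv p : forall e G, (G ⊩ tr e p) <-> prv INF G (ren e p).
Proof.
  induction p; intros e G; simpl; try reflexivity.
  - rewrite IHp1, IHp2. split.
    + intros [? ?]. now apply prv_andI.
    + intros H. split; [eapply prv_andE1 | eapply prv_andE2]; eauto.
  - split.
    + intros H. apply H; auto; intros G' _ H'; [apply prv_orI1 | apply prv_orI2];
        [apply IHp1 | apply IHp2]; auto.
    + intros H q G' HG K1 K2. eapply prv_orE.
      * eapply prv_incl; eauto.
      * apply K1; auto. apply IHp1. apply prv_hyp; auto.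
      * apply K2; auto. apply IHp2. apply prv_hyp; auto.
  - split.
    + intros H. apply prv_impI, IHp2, H; auto. apply IHp1, prv_hyp; auto.
    + intros H G' HG H1. apply IHp2. eapply prv_impE; [|apply IHp1; eauto].
      eapply prv_incl; eauto.
  - split.
    + intros H. apply prv_allI_inst. intros y. rewrite inst_up. now apply IHp.
    + intros H x. apply IHp. rewrite <- inst_up. now apply prv_allE.
  - split.
    + intros H. apply H; auto. intros x G' _ H'. apply prv_exI with (y := x).
      rewrite inst_up. now apply IHp.
    + intros H q G' HG K. eapply prv_exE_inst.
      * eapply prv_incl; eauto.
      * intros y. apply (K y); auto. apply IHp. rewrite inst_up.
        apply prv_hyp; auto.
Qed.

Lemma tr_ren p e r G : (G ⊩ tr e (ren r p)) <-> (G ⊩ tr (fun n => e (r n)) p).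
Proof. rewrite !tr_prv, ren_ren. reflexivity. Qed.

Lemma tr_ext p e e' G : (forall n, e n = e' n) -> (G ⊩ tr e p) -> (G ⊩ tr e' p).
Proof. rewrite !tr_prv. intros H. now rewrite (ren_ext p e e'). Qed.

(** * Derived rules and the axioms of INF in the model *)

Lemma mp {G P Q} : (G ⊩ himp P Q) -> (G ⊩ P) -> (G ⊩ Q).
Proof. intros H. apply H, incl_refl. Qed.

Lemma fwd {G P Q} : (G ⊩ hiff P Q) -> (G ⊩ P) -> (G ⊩ Q).
Proof. intros [H _]. exact (mp H). Qed.

Lemma bwd {G P Q} : (G ⊩ hiff P Q) -> (G ⊩ Q) -> (G ⊩ P).
Proof. intros [_ H]. exact (mp H). Qed.

Lemma hex_intro {G} {P : D -> truth} x : (G ⊩ P x) -> (G ⊩ hex P).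
Proof. intros H q G' HG K. apply (K x); auto. eapply holds_incl; eauto. Qed.

Arguments hex_intro {G P} & x _.

Lemma hand_intro {G} {P Q : truth} : (G ⊩ P) -> (G ⊩ Q) -> G ⊩ hand P Q.
Proof. exact (@conj _ _). Qed.

Arguments hand_intro {G P Q} & _ _.

Lemma hor_introl {G} {P Q : truth} : (G ⊩ P) -> (G ⊩ hor P Q).
Proof. intros H q G' HG K _. apply K; auto. eapply holds_incl; eauto. Qed.

Lemma hor_intror {G} {P Q : truth} : (G ⊩ Q) -> (G ⊩ hor P Q).
Proof. intros H q G' HG _ K. apply K; auto. eapply holds_incl; eauto. Qed.

Arguments hor_introl {G P Q} & _.
Arguments hor_intror {G P Q} & _.

Lemma hbot_elim {G} P : (G ⊩ hbot) -> (G ⊩ P).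
Proof.
  intros H. apply holds_closed. intros q G' HG _.
  apply prv_botE. exact (prv_incl _ _ _ _ H HG).
Qed.

Lemma heq_refl {G} x : G ⊩ heq x x.
Proof. apply prv_eqI. Qed.

Lemma extensionality {G} x y :
  (G ⊩ hall (fun z => hiff (hmem z x) (hmem z y))) -> (G ⊩ heq x y).
Proof.
  assert (H : G ⊩ tr (fun n => n)
    (All (All (Imp (All (Iff (Mem 0 1) (Mem 0 2))) (Eq 0 1))))).
  { apply tr_prv. rewrite ren_id by reflexivity.
    apply prv_ax, INF_extensionality. }
  exact (mp (H y x)).
Qed.

(** [p] is a formula that defines [P] with its parameters assigned by [e]. Arbitrary parameters are
    allowed because [prv_nil_subst] gives every substitution instance of the axiom. *)
Lemma comprehension {G} (P : D -> truth) p e :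
  stratified p -> (forall x, tr (scons x e) p = P x) ->
  G ⊩ hex (fun a => hall (fun x => hiff (hmem x a) (P x))).
Proof.
  intros Hp HP.
  assert (H : G ⊩ tr e (Ex (All (Iff (Mem 0 1) (ren (up S) p))))).
  { apply tr_prv. eapply prv_incl; [|apply incl_nil_l].
    apply prv_nil_subst, prv_ax, INF_comprehension, Hp. }
  intros q G' HG K. apply (H q G' HG). intros a G1 HG1 Ha. apply (K a G1 HG1).
  intros x. rewrite <- HP. destruct (Ha x) as [H1 H2].
  (* The renaming [up S] skips the new set [a], so that on [p] the assignment [scons x (scons a e)]
     acts as [scons x e]. *)
  split; intros G2 HG2 HP2.
  - refine (tr_ext p _ _ G2 _ (proj1 (tr_ren p _ _ G2) (H1 G2 HG2 HP2))).
    intros [|n]; reflexivity.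
  - refine (H2 G2 HG2 (proj2 (tr_ren p _ _ G2) (tr_ext p _ _ G2 _ HP2))).
    intros [|n]; reflexivity.
Qed.

Lemma leibniz {G} (P : D -> truth) p e a b :
  (forall x, tr (scons x e) p = P x) -> (G ⊩ heq a b) -> (G ⊩ P a) -> (G ⊩ P b).
Proof.
  intros HP Hab. rewrite <- !HP, !tr_prv, <- !inst_up. now apply prv_eqE.
Qed.

(** * Derivations in the semantics *)

Notation "x ∈ y" := (hmem x y) (at level 70, no associativity) : truth_scope.
Notation "x ≐ y" := (heq x y) (at level 70, no associativity) : truth_scope.
Notation "¬ P" := (himp P hbot) (at level 75, right associativity) : truth_scope.
Notation "P ∧ Q" := (hand P Q) (at level 80, right associativity) : truth_scope.
Notation "P ∨ Q" := (hor P Q) (at level 85, right associativity) : truth_scope.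
Notation "P ⟷ Q" := (hiff P Q) (at level 95, no associativity) : truth_scope.
Notation "P ⟶ Q" := (himp P Q) (at level 99, right associativity) : truth_scope.
Notation "∀ x .. y , P" := (hall (fun x => .. (hall (fun y => P)) ..))
  (at level 200, x binder, y binder, right associativity) : truth_scope.
Notation "∃ x .. y , P" := (hex (fun x => .. (hex (fun y => P)) ..))
  (at level 200, x binder, y binder, right associativity) : truth_scope.
Close Scope inf_scope.
Open Scope truth_scope.

(** * The notions of the theorem as truth values *)

Definition is_empty (e : D) : truth := ∀ x, x ∈ e ⟷ hbot.
Definition is_singleton (x s : D) : truth := ∀ u, u ∈ s ⟷ u ≐ x.
Definition is_upair (x y s : D) : truth := ∀ u, u ∈ s ⟷ u ≐ x ∨ u ≐ y.
(** The nesting of the existential quantifiers is the one into which the contextual term [opair]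
    unfolds, so that [tr_theorem] can hold by computation. *)
Definition with_opair (x y : D) (k : D -> truth) : truth :=
  ∃ a, is_singleton x a ∧ ∃ b, is_upair x y b ∧ ∃ p, is_upair a b p ∧ k p.
Definition is_opair (x y p : D) : truth := with_opair x y (fun q => p ≐ q).
Definition rel (r x y : D) : truth := with_opair x y (fun p => p ∈ r).
Definition is_union (x s z : D) : truth := ∀ u, u ∈ z ⟷ u ∈ x ∨ u ∈ s.

Definition is_adjoin (x c z : D) : truth := ∀ u, u ∈ z ⟷ u ∈ x ∨ u ≐ c.

Definition functional (f : D) : truth :=
  ∀ x y z, rel f x y ⟶ rel f x z ⟶ y ≐ z.
Definition in_FUNC (f : D) : truth :=
  ∃ F, (∀ g, g ∈ F ⟷ functional g) ∧ f ∈ F.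

(** An invariant of the Church numbers. The successor composes [f] only with iterates [t] in [FUNC],
    so without it the iteration could not be continued. *)
Definition preserves_functional (n : D) : truth :=
  ∀ f t, functional f ⟶ rel n f t ⟶ functional t.

Definition is_app (f x a : D) : truth := ∀ t, t ∈ a ⟷ ∃ y, rel f x y ∧ t ∈ y.

Definition is_id (i : D) : truth := ∀ u, u ∈ i ⟷ ∃ x, x ≐ x ∧ is_opair x x u.
Definition is_zero (z : D) : truth :=
  ∀ u, u ∈ z ⟷ ∃ f, f ≐ f ∧ ∃ i, is_id i ∧ is_opair f i u.

Definition is_next_iterate (n f p : D) : truth :=
  ∀ u, u ∈ p ⟷ ∃ x w t q,
    is_opair x w u ∧ in_FUNC t ∧ rel n f t ∧ rel t x q ∧ rel f q w.
Definition is_succ_of (n s : D) : truth :=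
  ∀ v, v ∈ s ⟷ ∃ f p, is_opair f p v ∧ in_FUNC f ∧ is_next_iterate n f p.
Definition is_succ (S : D) : truth :=
  ∀ v, v ∈ S ⟷ ∃ n, in_FUNC n ∧ ∃ s, is_succ_of n s ∧ is_opair n s v.

Definition inductive (w : D) : truth :=
  (∃ z, is_zero z ∧ z ∈ w) ∧
  ∀ x, x ∈ w ⟶ ∃ S, is_succ S ∧ ∃ a, is_app S x a ∧ a ∈ w.
Definition is_NN (N : D) : truth := ∀ n, n ∈ N ⟷ ∀ w, inductive w ⟶ n ∈ w.

Definition adjunction_closed (w : D) : truth :=
  (∃ e, is_empty e ∧ e ∈ w) ∧
  ∀ x c, x ∈ w ∧ (c ∈ x ⟶ hbot) ⟶
    ∃ s, is_singleton c s ∧ ∃ z, is_union x s z ∧ z ∈ w.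
Definition finite (y : D) : truth := ∀ w, adjunction_closed w ⟶ y ∈ w.

Definition counting : truth :=
  ∀ j, (∃ N, is_NN N ∧ j ∈ N) ⟶
    ∃ S, is_succ S ∧ ∃ g, is_app j S g ∧
    ∃ z, is_zero z ∧ ∃ a, is_app g z a ∧ a ≐ j.

(** This ties the relational definitions above to the terms of the statement: both sides compute to
    the same truth value. *)
Lemma tr_theorem (e : nat -> D) :
  tr e (sentence (simp church_counting (sneg (smem NN FINITE)))) =
  (counting ⟶
   (∃ N, is_NN N ∧ ∃ F, (∀ y, y ∈ F ⟷ finite y) ∧ N ∈ F) ⟶ hbot).
Proof. cbv -[hmem heq hand hor himp hall hex hbot]. reflexivity. Qed.

#[local] Hint Constants Opaque : typeclass_instances.

(** Disjunction and existence hold only after passing to extensions of the context, so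
    they are eliminated, towards a truth value, into Rocq's own connectives [Q]. *)
Class Cases (P : truth) (Q : list form -> Prop) : Prop := {
  cases_incl : forall G G', incl G G' -> Q G -> Q G';
  cases : forall (C : truth) G, (G ⊩ P) ->
    (forall G', incl G G' -> Q G' -> G' ⊩ C) -> G ⊩ C }.

#[local] Instance cases_atom P : Cases P P | 100.
Proof.
  split; [apply holds_incl|]. intros C G H K. apply (K G); auto.
Qed.

#[local] Instance cases_and P Q P' Q' :
  Cases P P' -> Cases Q Q' -> Cases (P ∧ Q) (fun G => P' G /\ Q' G).
Proof.
  intros HP HQ. split.
  - intros G G' L [? ?]. split; eapply cases_incl; eauto.
  - intros C G [H1 H2] K. apply (cases C G H1). intros G' L H1'.
    apply (cases C G' (holds_incl _ _ _ L H2)). intros G'' L' H2'.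
    apply K; eauto. split; auto. eapply (cases_incl (P := P)); eauto.
Qed.

#[local] Instance cases_or P Q P' Q' :
  Cases P P' -> Cases Q Q' -> Cases (P ∨ Q) (fun G => P' G \/ Q' G).
Proof.
  intros HP HQ. split.
  - intros G G' L [?|?]; [left|right]; eapply cases_incl; eauto.
  - intros C G H K. apply holds_closed. intros q G1 L1 KC.
    apply (H q G1 L1); intros G2 L2 H2.
    + apply KC; auto. apply (cases C G2 H2). intros G3 L3 H3.
      apply K; eauto.
    + apply KC; auto. apply (cases C G2 H2). intros G3 L3 H3.
      apply K; eauto.
Qed.

#[local] Instance cases_ex P P' :
  (forall x, Cases (P x) (P' x)) -> Cases (hex P) (fun G => exists x, P' x G).
Proof.
  intros HP. split.
  - intros G G' L [x ?]. exists x. eapply cases_incl; eauto.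
  - intros C G H K. apply holds_closed. intros q G1 L1 KC.
    apply (H q G1 L1). intros x G2 L2 H2.
    apply KC; auto. apply (cases C G2 H2). intros G3 L3 H3.
    apply K; eauto.
Qed.

(** Truth is monotone in the context, so all hypotheses can be moved to the extension and the old
    context forgotten. *)
Ltac extend L :=
  let G := lazymatch type of L with incl ?G _ => G end in
  repeat match goal with h : holds _ G |- _ => apply (holds_incl _ _ _ L) in h end;
  clear L; try clear G.

Tactic Notation "elim_cases" open_constr(h) "as" simple_intropattern(p) :=
  let G' := fresh "G" in let L := fresh "L" in
  refine (cases _ _ h _); try clear h; intros G' L; extend L; cbv beta; intros p.

Tactic Notation "assume" ident(h) :=
  let G' := fresh "G" in let L := fresh "L" in
  lazymatch goal with |- holds (himp _ _) _ => idtac end;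
  intros G' L; extend L; intros h; cbv beta in h.

Tactic Notation "assume_cases" simple_intropattern(p) :=
  let h := fresh "h" in assume h; elim_cases h as p.

Tactic Notation "claim" ident(h) ":" constr(P) :=
  lazymatch goal with |- holds _ ?G => assert (h : G ⊩ P) end.

Ltac index_of x env :=
  lazymatch env with
  | scons x _ => constr:(0)
  | scons _ ?t => let n := index_of x t in constr:(S n)
  end.

(** Recovers a formula from a truth value, since comprehension and Leibniz's law hold
    only of definable predicates. *)
Ltac reify env P :=
  lazymatch P with
  | hbot => constr:(Bot)
  | hmem ?x ?y =>
      let i := index_of x env in let j := index_of y env in constr:(Mem i j)
  | heq ?x ?y =>
      let i := index_of x env in let j := index_of y env in constr:(Eq i j)
  | hand ?P ?Q => let p := reify env P in let q := reify env Q in constr:(And p q)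
  | hor ?P ?Q => let p := reify env P in let q := reify env Q in constr:(Or p q)
  | himp ?P ?Q => let p := reify env P in let q := reify env Q in constr:(Imp p q)
  | hall ?f => let p := reify_fun env f in constr:(All p)
  | hex ?f => let p := reify_fun env f in constr:(Ex p)
  end
with reify_fun env f :=
  let y := fresh "individual" in
  let t := constr:(fun y : D => ltac:(
    let P := eval cbv beta in (f y) in
    let r := reify constr:(scons y env) P in exact r)) in
  lazymatch t with fun _ => ?r => r end.

Ltac individuals env :=
  match goal with
  | x : D |- _ =>
      lazymatch env with context [x] => fail | _ => individuals constr:(scons x env) end
  | _ => env
  end.

Ltac unfold_truth P :=
  eval cbv beta delta [
    is_empty is_singleton is_upair with_opair is_opair rel is_union is_adjoin functional preserves_functional
    in_FUNC is_app is_id is_zero is_next_iterate is_succ_of is_succ inductive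
    is_NN adjunction_closed finite hiff] in P.

Ltac indices env :=
  lazymatch env with
  | scons _ ?t => let s := indices t in let i := open_constr:(_ : nat) in constr:(scons i s)
  | _ => constr:(fun _ : nat => 0)
  end.

(** The indices are found by unification, as every constraint has the form
    [i = j] or [j = S i]. *)
Ltac stratify env :=
  let s := indices constr:(scons 0 env) in
  exists s; simpl;
  repeat match goal with
  | |- exists _, _ => eexists
  | |- _ /\ _ => split
  | |- True => exact I
  | |- _ = _ => reflexivity
  end.

Ltac tr_eq := intros; cbv -[hmem heq hand hor himp hall hex hbot]; reflexivity.

Tactic Notation "comprehend" constr(P) "as" ident(A) ident(HA) :=
  let env := individuals constr:(fun _ : nat => 0) in
  let P' := unfold_truth P in
  let p := reify_fun env P' in
  let G := lazymatch goal with |- holds _ ?G => G end in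
  let Hs := fresh in
  assert (Hs : stratified p) by (unshelve (stratify env); exact 0);
  elim_cases (@comprehension G P p env Hs ltac:(tr_eq)) as [A HA];
  clear Hs; cbv beta in HA.

Ltac transfer H P h :=
  let env := individuals constr:(fun _ : nat => 0) in
  let P' := unfold_truth P in
  let p := reify_fun env P' in
  refine (leibniz P p env _ _ ltac:(tr_eq) H h).

Lemma heq_sym {G} x y : (G ⊩ x ≐ y) -> (G ⊩ y ≐ x).
Proof. intros H. transfer H (fun z => z ≐ x) (heq_refl (G := G) x). Qed.

Lemma heq_trans {G} x y z : (G ⊩ x ≐ y) -> (G ⊩ y ≐ z) -> (G ⊩ x ≐ z).
Proof. intros H H'. transfer H' (fun z => x ≐ z) H. Qed.

Ltac rewrite_eq H :=
  lazymatch type of H with holds (heq ?a ?b) ?G =>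
    repeat match goal with h : holds ?P G |- _ =>
      lazymatch h with H => fail | _ => idtac end;
      lazymatch P with context [a] => idtac end;
      let F := lazymatch eval pattern a in P with ?F _ => F end in
      let h' := fresh in
      let Pb := eval cbv beta in (F b) in
      assert (h' : holds Pb G) by (transfer H F h);
      clear h; rename h' into h
    end;
    lazymatch goal with
    | |- holds ?P G =>
      lazymatch P with
      | context [a] =>
        let F := lazymatch eval pattern a in P with ?F _ => F end in
        let Pb := eval cbv beta in (F b) in
        let h' := fresh in
        enough (h' : holds Pb G) by (transfer (heq_sym _ _ H) F h')
      | _ => idtac
      end
    end; clear H; try clear a
  end.

(** * Pairs and relations *)

Lemma sets_eq {G} (P : D -> truth) a b : (G ⊩ ∀ u, u ∈ a ⟷ P u) ->
  (G ⊩ ∀ u, u ∈ b ⟷ P u) -> G ⊩ a ≐ b.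
Proof.
  intros Ha Hb. apply extensionality. intros u.
  split; assume h.
  - exact (bwd (Hb u) (fwd (Ha u) h)).
  - exact (bwd (Ha u) (fwd (Hb u) h)).
Qed.

Lemma singleton_ex {G} x : G ⊩ ∃ s, is_singleton x s.
Proof.
  comprehend (fun u => u ≐ x) as s Hs. exact (hex_intro s Hs).
Qed.

Lemma upair_ex {G} x y : G ⊩ ∃ s, is_upair x y s.
Proof.
  comprehend (fun u => u ≐ x ∨ u ≐ y) as s Hs. exact (hex_intro s Hs).
Qed.

Lemma with_opair_intro {G} x y a b p k : (G ⊩ is_singleton x a) ->
  (G ⊩ is_upair x y b) -> (G ⊩ is_upair a b p) -> (G ⊩ k p) ->
  G ⊩ with_opair x y k.
Proof.
  intros Ha Hb Hp Hk.
  exact (hex_intro a (hand_intro Ha (hex_intro b (hand_intro Hb (hex_intro p (hand_intro Hp Hk)))))).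
Qed.

Lemma opair_ex {G} x y : G ⊩ ∃ p, is_opair x y p.
Proof.
  elim_cases (singleton_ex x) as [a Ha].
  elim_cases (upair_ex x y) as [b Hb].
  elim_cases (upair_ex a b) as [p Hp].
  exact (hex_intro p (with_opair_intro _ _ _ _ _ _ Ha Hb Hp (heq_refl p))).
Qed.

Lemma mem_opair {G} x y p : (G ⊩ is_opair x y p) ->
  G ⊩ ∀ u, u ∈ p ⟷ is_singleton x u ∨ is_upair x y u.
Proof.
  intros H. unfold is_opair, with_opair in H.
  elim_cases H as (a & Ha & b & Hb & q & Hq & E).
  apply heq_sym in E. rewrite_eq E. intros u. split.
  - assume h. elim_cases (fwd (Hq u) h) as [E|E]; apply heq_sym in E; rewrite_eq E.
    + exact (hor_introl Ha).
    + exact (hor_intror Hb).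
  - assume_cases [h|h]; apply (bwd (Hq u)).
    + exact (hor_introl (sets_eq _ _ _ h Ha)).
    + exact (hor_intror (sets_eq _ _ _ h Hb)).
Qed.

(** The classical argument decides whether [x] equals [y]. Here each case split is on a disjunction
    provided by membership in the pair or in one of its elements, so the argument is
    intuitionistic. *)
Lemma opair_inj {G} x y x' y' p : (G ⊩ is_opair x y p) ->
  (G ⊩ is_opair x' y' p) -> G ⊩ x ≐ x' ∧ y ≐ y'.
Proof.
  intros H H'. apply mem_opair in H, H'.
  claim Ex : (x ≐ x').
  { elim_cases (singleton_ex x) as [a Ha].
    elim_cases (fwd (H' a) (bwd (H a) (hor_introl Ha))) as [Ha'|Ha'].
    - exact (fwd (Ha' x) (bwd (Ha x) (heq_refl x))).
    - apply heq_sym. exact (fwd (Ha x') (bwd (Ha' x') (hor_introl (heq_refl x')))). }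
  split; [exact Ex|].
  apply heq_sym in Ex. rewrite_eq Ex.
  elim_cases (upair_ex x y) as [b Hb].
  elim_cases (upair_ex x y') as [b' Hb'].
  claim K : (y ≐ x ∨ y ≐ y').
  { elim_cases (fwd (H' b) (bwd (H b) (hor_intror Hb))) as [h|h].
    - apply hor_introl. exact (fwd (h y) (bwd (Hb y) (hor_intror (heq_refl y)))).
    - exact (fwd (h y) (bwd (Hb y) (hor_intror (heq_refl y)))). }
  elim_cases K as [E|E]; [|exact E].
  rewrite_eq E.
  elim_cases (fwd (H b') (bwd (H' b') (hor_intror Hb'))) as [h|h].
  - apply heq_sym. exact (fwd (h y') (bwd (Hb' y') (hor_intror (heq_refl y')))).
  - elim_cases (fwd (h y') (bwd (Hb' y') (hor_intror (heq_refl y')))) as [E|E];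
      apply heq_sym; exact E.
Qed.

Lemma rel_intro {G} r x y p :
  (G ⊩ is_opair x y p) -> (G ⊩ p ∈ r) -> G ⊩ rel r x y.
Proof.
  intros H Hr. unfold is_opair, with_opair in H.
  elim_cases H as (a & Ha & b & Hb & q & Hq & E). rewrite_eq E.
  exact (with_opair_intro _ _ _ _ _ _ Ha Hb Hq Hr).
Qed.

Lemma rel_elim {G} r x y : (G ⊩ rel r x y) -> G ⊩ ∃ p, is_opair x y p ∧ p ∈ r.
Proof.
  intros H. unfold rel, with_opair in H.
  elim_cases H as (a & Ha & b & Hb & q & Hq & Hr).
  refine (hex_intro q (hand_intro _ Hr)).
  exact (with_opair_intro _ _ _ _ _ _ Ha Hb Hq (heq_refl q)).
Qed.

(** By injectivity of pairs a set of pairs gives back the relation it was built from. The components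
    are recovered only up to [≐], so [R] has to respect it. *)
Lemma rel_comprehension (R : D -> D -> truth) {G} r :
  (G ⊩ ∀ u, u ∈ r ⟷ ∃ x y, is_opair x y u ∧ R x y) ->
  (forall G x y x' y', (G ⊩ x ≐ x') -> (G ⊩ y ≐ y') -> (G ⊩ R x y) -> G ⊩ R x' y') ->
  G ⊩ ∀ x y, rel r x y ⟷ R x y.
Proof.
  intros H HR x y. split.
  - assume h. elim_cases (rel_elim _ _ _ h) as (p & Hp & h').
    elim_cases (fwd (H p) h') as (x' & y' & Hp' & h'').
    destruct (opair_inj _ _ _ _ _ Hp' Hp) as [Ex Ey].
    exact (HR _ _ _ _ _ Ex Ey h'').
  - assume h. elim_cases (opair_ex x y) as [p Hp].
    apply (rel_intro _ _ _ p Hp). refine (bwd (H p) _).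
    exact (hex_intro x (hex_intro y (hand_intro Hp h))).
Qed.

Tactic Notation "comprehend_rel" constr(R) "as" ident(r) ident(Hr) :=
  let R' := eval cbv beta in (fun u => ∃ x y, is_opair x y u ∧ R x y) in
  comprehend R' as r Hr;
  apply (rel_comprehension R) in Hr; [|intros; repeat
    match goal with h : holds (heq _ _) _ |- _ => rewrite_eq h end; assumption].

Lemma functionalE {G} f x y z : (G ⊩ functional f) -> (G ⊩ rel f x y) ->
  (G ⊩ rel f x z) -> G ⊩ y ≐ z.
Proof. intros H h h'. exact (mp (mp (H x y z) h) h'). Qed.

Lemma in_FUNC_functional {G} f : (G ⊩ in_FUNC f) -> G ⊩ functional f.
Proof. intros H. unfold in_FUNC in H. elim_cases H as (F & HF & h). exact (fwd (HF f) h). Qed.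

Lemma functional_in_FUNC {G} f : (G ⊩ functional f) -> G ⊩ in_FUNC f.
Proof.
  intros H. unfold in_FUNC. comprehend (fun g => functional g) as F HF.
  exact (hex_intro F (hand_intro HF (bwd (HF f) H))).
Qed.

Lemma app_ex {G} f x : G ⊩ ∃ a, is_app f x a.
Proof.
  comprehend (fun t => ∃ y, rel f x y ∧ t ∈ y) as a Ha. exact (hex_intro a Ha).
Qed.

Lemma app_eq {G} f x y a : (G ⊩ functional f) -> (G ⊩ rel f x y) ->
  (G ⊩ is_app f x a) -> G ⊩ a ≐ y.
Proof.
  intros Hf h Ha. apply extensionality. intros t. split; assume Ht.
  - elim_cases (fwd (Ha t) Ht) as (y' & h' & Ht').
    pose proof (functionalE _ _ _ _ Hf h' h) as E. rewrite_eq E. assumption.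
  - exact (bwd (Ha t) (hex_intro y (hand_intro h Ht))).
Qed.

(** * Church numbers *)

Lemma id_ex {G} : G ⊩ ∃ i, is_id i.
Proof.
  comprehend (fun u => ∃ x, x ≐ x ∧ is_opair x x u) as i Hi. exact (hex_intro i Hi).
Qed.

Lemma rel_id {G} i x y : (G ⊩ is_id i) -> G ⊩ rel i x y ⟷ x ≐ y.
Proof.
  intros Hi. split.
  - assume h. elim_cases (rel_elim _ _ _ h) as (p & Hp & h').
    elim_cases (fwd (Hi p) h') as (z & _ & Hz).
    destruct (opair_inj _ _ _ _ _ Hz Hp) as [Ex Ey].
    exact (heq_trans _ _ _ (heq_sym _ _ Ex) Ey).
  - assume E. rewrite_eq E. elim_cases (opair_ex y y) as [p Hp].
    apply (rel_intro _ _ _ p Hp), (bwd (Hi p)).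
    exact (hex_intro y (hand_intro (heq_refl y) Hp)).
Qed.

Lemma functional_id {G} i : (G ⊩ is_id i) -> G ⊩ functional i.
Proof.
  intros Hi x y z. assume h. assume h'.
  exact (heq_trans _ _ _ (heq_sym _ _ (fwd (rel_id _ _ _ Hi) h)) (fwd (rel_id _ _ _ Hi) h')).
Qed.

Lemma zero_ex {G} : G ⊩ ∃ z, is_zero z.
Proof.
  comprehend (fun u => ∃ f, f ≐ f ∧ ∃ i, is_id i ∧ is_opair f i u) as z Hz.
  exact (hex_intro z Hz).
Qed.

Lemma rel_zero {G} z f t : (G ⊩ is_zero z) -> G ⊩ rel z f t ⟷ is_id t.
Proof.
  intros Hz. split.
  - assume h. elim_cases (rel_elim _ _ _ h) as (p & Hp & h').
    elim_cases (fwd (Hz p) h') as (f' & _ & i & Hi & Hp').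
    destruct (opair_inj _ _ _ _ _ Hp' Hp) as [_ E]. rewrite_eq E. assumption.
  - assume h. elim_cases (opair_ex f t) as [p Hp].
    apply (rel_intro _ _ _ p Hp), (bwd (Hz p)).
    exact (hex_intro f (hand_intro (heq_refl f) (hex_intro t (hand_intro h Hp)))).
Qed.

Lemma next_iterate_ex {G} n f : G ⊩ ∃ p, is_next_iterate n f p.
Proof.
  comprehend (fun u => ∃ x w t q, is_opair x w u ∧ in_FUNC t ∧ rel n f t ∧
    rel t x q ∧ rel f q w) as p Hp.
  exact (hex_intro p Hp).
Qed.

Lemma rel_next_iterate {G} n f p x w : (G ⊩ is_next_iterate n f p) ->
  G ⊩ rel p x w ⟷ ∃ t q, functional t ∧ rel n f t ∧ rel t x q ∧ rel f q w.
Proof.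
  intros Hp. split.
  - assume h. elim_cases (rel_elim _ _ _ h) as (u & Hu & h').
    elim_cases (fwd (Hp u) h') as (x' & w' & t & q & Hu' & Ht & H1 & H2 & H3).
    destruct (opair_inj _ _ _ _ _ Hu' Hu) as [Ex Ew].
    rewrite_eq Ex. rewrite_eq Ew. apply in_FUNC_functional in Ht.
    exact (hex_intro t (hex_intro q
      (hand_intro Ht (hand_intro H1 (hand_intro H2 H3))))).
  - assume_cases (t & q & Ht & H1 & H2 & H3). apply functional_in_FUNC in Ht.
    elim_cases (opair_ex x w) as [u Hu].
    apply (rel_intro _ _ _ u Hu), (bwd (Hp u)).
    exact (hex_intro x (hex_intro w (hex_intro t (hex_intro q (hand_intro Hu
      (hand_intro Ht (hand_intro H1 (hand_intro H2 H3)))))))).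
Qed.

Lemma succ_of_ex {G} n : G ⊩ ∃ s, is_succ_of n s.
Proof.
  comprehend (fun v => ∃ f p, is_opair f p v ∧ in_FUNC f ∧ is_next_iterate n f p)
    as s Hs.
  exact (hex_intro s Hs).
Qed.

Lemma rel_succ_of {G} n s f p : (G ⊩ is_succ_of n s) ->
  G ⊩ rel s f p ⟷ functional f ∧ is_next_iterate n f p.
Proof.
  intros Hs. split.
  - assume h. elim_cases (rel_elim _ _ _ h) as (v & Hv & h').
    elim_cases (fwd (Hs v) h') as (f' & p' & Hv' & Hf & Hp).
    destruct (opair_inj _ _ _ _ _ Hv' Hv) as [Ef Ep].
    rewrite_eq Ef. rewrite_eq Ep. exact (hand_intro (in_FUNC_functional _ Hf) Hp).
  - assume_cases (Hf & Hp). apply functional_in_FUNC in Hf.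
    elim_cases (opair_ex f p) as [v Hv].
    apply (rel_intro _ _ _ v Hv), (bwd (Hs v)).
    exact (hex_intro f (hex_intro p (hand_intro Hv (hand_intro Hf Hp)))).
Qed.

Lemma succ_ex {G} : G ⊩ ∃ S, is_succ S.
Proof.
  comprehend (fun v => ∃ n, in_FUNC n ∧ ∃ s, is_succ_of n s ∧ is_opair n s v) as S HS.
  exact (hex_intro S HS).
Qed.

Lemma rel_succ {G} S n s : (G ⊩ is_succ S) ->
  G ⊩ rel S n s ⟷ functional n ∧ is_succ_of n s.
Proof.
  intros HS. split.
  - assume h. elim_cases (rel_elim _ _ _ h) as (v & Hv & h').
    elim_cases (fwd (HS v) h') as (n' & Hn & s' & Hs & Hv').
    destruct (opair_inj _ _ _ _ _ Hv' Hv) as [En Es].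
    rewrite_eq En. rewrite_eq Es. exact (hand_intro (in_FUNC_functional _ Hn) Hs).
  - assume_cases (Hn & Hs). apply functional_in_FUNC in Hn.
    elim_cases (opair_ex n s) as [v Hv].
    apply (rel_intro _ _ _ v Hv), (bwd (HS v)).
    exact (hex_intro n (hand_intro Hn (hex_intro s (hand_intro Hs Hv)))).
Qed.

Lemma functional_succ {G} S : (G ⊩ is_succ S) -> G ⊩ functional S.
Proof.
  intros HS x y z. assume h. assume h'.
  exact (sets_eq _ _ _ (proj2 (fwd (rel_succ _ _ _ HS) h)) (proj2 (fwd (rel_succ _ _ _ HS) h'))).
Qed.

Lemma functional_succ_of {G} n s : (G ⊩ is_succ_of n s) -> G ⊩ functional s.
Proof.
  intros Hs f p p'. assume h. assume h'.
  exact (sets_eq _ _ _ (proj2 (fwd (rel_succ_of _ _ _ _ Hs) h))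
    (proj2 (fwd (rel_succ_of _ _ _ _ Hs) h'))).
Qed.

Lemma functional_zero {G} z : (G ⊩ is_zero z) -> G ⊩ functional z.
Proof.
  intros Hz f t t'. assume h. assume h'.
  exact (sets_eq _ _ _ (fwd (rel_zero _ _ _ Hz) h) (fwd (rel_zero _ _ _ Hz) h')).
Qed.

Lemma preserves_functional_zero {G} z :
  (G ⊩ is_zero z) -> G ⊩ preserves_functional z.
Proof.
  intros Hz f t. assume_cases _. assume h. exact (functional_id _ (fwd (rel_zero _ _ _ Hz) h)).
Qed.

Lemma preserves_functional_succ_of {G} n s : (G ⊩ functional n) ->
  (G ⊩ is_succ_of n s) -> G ⊩ preserves_functional s.
Proof.
  intros Hn Hs f t. assume Hf. assume h. intros x y z.
  destruct (fwd (rel_succ_of _ _ _ _ Hs) h) as [_ Ht].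
  assume h1. assume h2.
  elim_cases (fwd (rel_next_iterate _ _ _ _ _ Ht) h1) as (t1 & q1 & Ht1 & K1 & L1 & M1).
  elim_cases (fwd (rel_next_iterate _ _ _ _ _ Ht) h2) as (t2 & q2 & Ht2 & K2 & L2 & M2).
  pose proof (functionalE _ _ _ _ Hn K1 K2) as E. rewrite_eq E.
  pose proof (functionalE _ _ _ _ Ht2 L1 L2) as E. rewrite_eq E.
  exact (functionalE _ _ _ _ Hf M1 M2).
Qed.

(** Closure in the definition of [N] concerns [Ap succ x]. It is identified with the successor of
    [x] through [rel_succ], which asks for [x] to be functional; hence the third premise. *)
Lemma NN_induction {G} N A : (G ⊩ is_NN N) ->
  (G ⊩ ∀ z, is_zero z ⟶ z ∈ A) ->
  (G ⊩ ∀ n, n ∈ A ⟶ functional n) ->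
  (G ⊩ ∀ n s, n ∈ A ⟶ is_succ_of n s ⟶ s ∈ A) ->
  G ⊩ ∀ n, n ∈ N ⟶ n ∈ A.
Proof.
  intros HN HZ HF HS n. assume Hn. refine (mp (fwd (HN n) Hn A) _). split.
  - elim_cases zero_ex as [z Hz]. exact (hex_intro z (hand_intro Hz (mp (HZ z) Hz))).
  - intros x. assume Hx.
    elim_cases succ_ex as [S HSucc]. elim_cases (succ_of_ex x) as [s Hs].
    elim_cases (app_ex S x) as [a Ha].
    refine (hex_intro S (hand_intro HSucc (hex_intro a (hand_intro Ha _)))).
    pose proof (app_eq _ _ _ _ (functional_succ _ HSucc)
      (bwd (rel_succ _ _ _ HSucc) (hand_intro (mp (HF x) Hx) Hs)) Ha) as E.
    apply heq_sym in E. apply (fun H => mp (mp (HS x s) Hx) H) in Hs.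
    rewrite_eq E. assumption.
Qed.

(** Functionality is what the induction itself consumes. That numbers are inhabited keeps the empty
    set out of [N]. *)
Lemma NN_numeral {G} N n : (G ⊩ is_NN N) -> (G ⊩ n ∈ N) ->
  G ⊩ (functional n ∧ preserves_functional n) ∧ ∃ u, u ∈ n.
Proof.
  intros HN Hn.
  comprehend (fun n => (functional n ∧ preserves_functional n) ∧ ∃ u, u ∈ n) as A HA.
  refine (fwd (HA n) (mp (NN_induction N A HN _ _ _ n) Hn)).
  - intros z. assume Hz. apply (bwd (HA z)). split; [split|].
    + now apply functional_zero.
    + now apply preserves_functional_zero.
    + elim_cases id_ex as [i Hi].
      elim_cases (rel_elim _ _ _ (bwd (rel_zero z i i Hz) Hi)) as (p & _ & Hp).
      exact (hex_intro p Hp).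
  - intros m. assume Hm. destruct (fwd (HA m) Hm) as [[Hf _] _]. exact Hf.
  - intros m s. assume Hm. assume Hs. apply (bwd (HA s)).
    destruct (fwd (HA m) Hm) as [[Hf _] _]. split; [split|].
    + exact (functional_succ_of _ _ Hs).
    + exact (preserves_functional_succ_of _ _ Hf Hs).
    + elim_cases id_ex as [i Hi]. apply functional_id in Hi.
      elim_cases (next_iterate_ex m i) as [q Hq].
      elim_cases (rel_elim _ _ _ (bwd (rel_succ_of _ _ i q Hs) (hand_intro Hi Hq)))
        as (p & _ & Hp).
      exact (hex_intro p Hp).
Qed.

Lemma zero_in_NN {G} N z : (G ⊩ is_NN N) -> (G ⊩ is_zero z) -> G ⊩ z ∈ N.
Proof.
  intros HN Hz. apply (bwd (HN z)). intros w. unfold inductive. assume_cases [(z' & Hz' & H) _].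
  pose proof (sets_eq _ _ _ Hz' Hz) as E. rewrite_eq E. assumption.
Qed.

Lemma succ_of_in_NN {G} N n s :
  (G ⊩ is_NN N) -> (G ⊩ n ∈ N) -> (G ⊩ is_succ_of n s) -> G ⊩ s ∈ N.
Proof.
  intros HN Hn Hs. apply (bwd (HN s)). intros w. assume Hw.
  destruct (NN_numeral _ _ HN Hn) as [[Hf _] _].
  destruct Hw as [Hw0 Hw].
  elim_cases (mp (Hw n) (mp (fwd (HN n) Hn w) (hand_intro Hw0 Hw)))
    as (S & HS & a & Ha & Haw).
  pose proof (app_eq _ _ _ _ (functional_succ _ HS)
      (bwd (rel_succ _ _ _ HS) (hand_intro Hf Hs)) Ha) as E.
  rewrite_eq E. assumption.
Qed.

(** * Finite sets *)

Lemma adjoin_ex {G} x c : G ⊩ ∃ z, is_adjoin x c z.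
Proof.
  comprehend (fun u => u ∈ x ∨ u ≐ c) as z Hz. exact (hex_intro z Hz).
Qed.

(** Induction is over a set [A], so every use first comprehends its induction hypothesis, which must
    therefore be stratified. *)
Lemma finite_induction {G} y A : (G ⊩ finite y) ->
  (G ⊩ ∀ e, is_empty e ⟶ e ∈ A) ->
  (G ⊩ ∀ x d z, x ∈ A ⟶ ¬ d ∈ x ⟶ is_adjoin x d z ⟶ z ∈ A) ->
  G ⊩ y ∈ A.
Proof.
  intros Hy He HA. refine (mp (Hy A) _). split.
  - comprehend (fun _ : D => hbot) as e Hempty.
    exact (hex_intro e (hand_intro Hempty (mp (He e) Hempty))).
  - intros x d. assume_cases (Hx & Hd).
    elim_cases (singleton_ex d) as [s Hs]. elim_cases (adjoin_ex x d) as [z Hz].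
    refine (hex_intro s (hand_intro Hs (hex_intro z (hand_intro _
      (mp (mp (mp (HA x d z) Hx) Hd) Hz))))).
    intros u. split; assume h.
    + elim_cases (fwd (Hz u) h) as [h'|h'].
      * exact (hor_introl h').
      * exact (hor_intror (bwd (Hs u) h')).
    + apply (bwd (Hz u)). elim_cases h as [h'|h'].
      * exact (hor_introl h').
      * exact (hor_intror (fwd (Hs u) h')).
Qed.

Lemma not_not_em {G} P : G ⊩ ¬ ¬ (P ∨ ¬ P).
Proof.
  assume h. refine (mp h _). apply hor_intror. assume h'.
  exact (mp h (hor_introl h')).
Qed.

(** In the induction step [d] is removed both as an argument and as a value of [W], leaving a
    function that covers [X] and [c] from [X] alone. Coverage is stated up to double negation, so
    that equality with [d] may be decided while proving it. *)
Lemma pigeonhole {G} X c : (G ⊩ finite X) -> (G ⊩ ¬ c ∈ X) ->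
  G ⊩ ∀ W, functional W ⟶
    (∀ z, z ∈ X ∨ z ≐ c ⟶ ¬ ¬ ∃ x, x ∈ X ∧ rel W x z) ⟶ hbot.
Proof.
  intros HX. apply mp.
  comprehend (fun X => ¬ c ∈ X ⟶ ∀ W, functional W ⟶
    (∀ z, z ∈ X ∨ z ≐ c ⟶ ¬ ¬ ∃ x, x ∈ X ∧ rel W x z) ⟶ hbot) as A HA.
  refine (fwd (HA X) (finite_induction X A HX _ _)); clear X HX.
  - intros e. assume He. apply (bwd (HA e)). assume_cases _. intros W. assume_cases _. assume H.
    refine (mp (mp (H c) (hor_intror (heq_refl c))) _). assume_cases (x & Hx & _).
    exact (fwd (He x) Hx).
  - intros X d Z. assume IH. assume Hd. assume HZ.
    apply (bwd (HA Z)). assume Hc. intros W. assume HW. assume onto.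
    assert (IH' := fwd (HA X) IH). cbv beta in IH'.
    claim HcX : (¬ c ∈ X).
    { assume h. exact (mp Hc (bwd (HZ c) (hor_introl h))). }
    apply (fun H => mp H HcX) in IH'.
    (* Preimages of [d] are rerouted to the value at [d]. *)
    comprehend_rel (fun x z => ∃ z', rel W x z' ∧
      ((¬ z' ≐ d ∧ z ≐ z') ∨ (z' ≐ d ∧ rel W d z))) as W' HW'.
    refine (mp (mp (IH' W') _) _).
    + intros x z1 z2. assume h1. assume h2.
      elim_cases (fwd (HW' x z1) h1) as (z1' & R1 & [(N1 & E1)|(E1 & S1)]);
        elim_cases (fwd (HW' x z2) h2) as (z2' & R2 & [(N2 & E2)|(E2 & S2)]);
        pose proof (functionalE _ _ _ _ HW R1 R2) as E; rewrite_eq E.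
      * exact (heq_trans _ _ _ E1 (heq_sym _ _ E2)).
      * exact (hbot_elim _ (mp N1 E2)).
      * exact (hbot_elim _ (mp N2 E1)).
      * exact (functionalE _ _ _ _ HW S1 S2).
    + intros z. assume Hz. assume K.
      claim Nz : (¬ z ≐ d).
      { assume E. elim_cases Hz as [Hz|Hz].
        - rewrite_eq E. exact (mp Hd Hz).
        - refine (mp Hc (bwd (HZ c) (hor_intror _))).
          exact (heq_trans _ _ _ (heq_sym _ _ Hz) E). }
      claim Hz' : (z ∈ Z ∨ z ≐ c).
      { elim_cases Hz as [Hz|Hz].
        - exact (hor_introl (bwd (HZ z) (hor_introl Hz))).
        - exact (hor_intror Hz). }
      refine (mp (mp (onto z) Hz') _). assume_cases (x & Hx & R).
      (* The goal is absurdity, so [x ≐ d] may be decided. *)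
      refine (mp (not_not_em (x ≐ d)) _). assume_cases [E|E].
      * rewrite_eq E.
        (* Now [W] sends [d] to [z], so [W'] sends any preimage [x'] of [d] to [z]. If [x'] were
           [d], functionality of [W] would give [z ≐ d]. *)
        refine (mp (mp (onto d) (hor_introl Hx)) _). assume_cases (x' & Hx' & R').
        elim_cases (fwd (HZ x') Hx') as [Hx''|E].
        -- refine (mp K (hex_intro x' (hand_intro Hx'' (bwd (HW' x' z) _)))).
           exact (hex_intro d (hand_intro R'
             (hor_intror (hand_intro (heq_refl d) R)))).
        -- rewrite_eq E. exact (mp Nz (functionalE _ _ _ _ HW R R')).
      * elim_cases (fwd (HZ x) Hx) as [Hx'|E']; [|exact (mp E E')].
        refine (mp K (hex_intro x (hand_intro Hx' (bwd (HW' x z) _)))).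
        exact (hex_intro z (hand_intro R (hor_introl (hand_intro Nz (heq_refl z))))).
Qed.

(** The orbit is expressed through the sets [o] that contain [c] and are closed under [f], so that
    no numbers occur. It is later applied with the range of a relation as [o]. *)
Lemma finite_orbit {G} X c : (G ⊩ finite X) -> (G ⊩ ¬ c ∈ X) ->
  G ⊩ ∃ f, functional f ∧
    (∀ o, c ∈ o ⟶ (∀ u v, u ∈ o ⟶ rel f u v ⟶ v ∈ o) ⟶
       ∀ z, z ∈ X ∨ z ≐ c ⟶ z ∈ o).
Proof.
  intros HX Hc0.
  (* The bound on the domain is added for the induction: it shows that the function obtained for the
     start [d] is undefined at the new start [c], so adding the pair of [c] and [d] keeps it
     functional. *)
  comprehend (fun X => ∀ c, ¬ c ∈ X ⟶ ∃ f, functional f ∧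
    (∀ u v, rel f u v ⟶ u ∈ X ∨ u ≐ c) ∧
    (∀ o, c ∈ o ⟶ (∀ u v, u ∈ o ⟶ rel f u v ⟶ v ∈ o) ⟶
       ∀ z, z ∈ X ∨ z ≐ c ⟶ z ∈ o)) as A HA.
  claim H : (X ∈ A).
  2: { elim_cases (mp (fwd (HA X) H c) Hc0) as (f & Hf & _ & Ho).
       exact (hex_intro f (hand_intro Hf Ho)). }
  refine (finite_induction X A HX _ _); clear X HX c Hc0.
  - intros e. assume He. apply (bwd (HA e)). intros c. assume_cases _.
    comprehend_rel (fun u v : D => hbot) as f Hf.
    refine (hex_intro f (hand_intro _ (hand_intro _ _))).
    + intros x y z. assume h. exact (hbot_elim _ (fwd (Hf x y) h)).
    + intros u v. assume h. exact (hbot_elim _ (fwd (Hf u v) h)).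
    + intros o. assume Ho. assume_cases _. intros z. assume_cases [h|h].
      * exact (hbot_elim _ (fwd (He z) h)).
      * rewrite_eq h. assumption.
  - intros X d Z. assume IH. assume Hd. assume HZ.
    apply (bwd (HA Z)). intros c. assume Hc.
    elim_cases (mp (fwd (HA X) IH d) Hd) as (f & Hf & Hdom & Horb).
    comprehend_rel (fun u v => rel f u v ∨ (u ≐ c ∧ v ≐ d)) as f' Hf'.
    claim Nc : (∀ v, ¬ rel f c v).
    { intros v. assume h. exact (mp Hc (bwd (HZ c) (mp (Hdom c v) h))). }
    refine (hex_intro f' (hand_intro _ (hand_intro _ _))).
    + intros u v w. assume h1. assume h2.
      elim_cases (fwd (Hf' u v) h1) as [R1|[E1 D1]];
        elim_cases (fwd (Hf' u w) h2) as [R2|[E2 D2]].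
      * exact (functionalE _ _ _ _ Hf R1 R2).
      * rewrite_eq E2. exact (hbot_elim _ (mp (Nc v) R1)).
      * rewrite_eq E1. exact (hbot_elim _ (mp (Nc w) R2)).
      * exact (heq_trans _ _ _ D1 (heq_sym _ _ D2)).
    + intros u v. assume h. elim_cases (fwd (Hf' u v) h) as [R|[E _]].
      * exact (hor_introl (bwd (HZ u) (mp (Hdom u v) R))).
      * exact (hor_intror E).
    + intros o. assume Ho. assume Hclosed.
      claim Hdo : (d ∈ o).
      { refine (mp (mp (Hclosed c d) Ho) (bwd (Hf' c d) _)).
        exact (hor_intror (hand_intro (heq_refl c) (heq_refl d))). }
      intros z. assume_cases [h|h].
      * refine (mp (mp (mp (Horb o) Hdo) _ z) (fwd (HZ z) h)).
        intros u v. assume Hu. assume R.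
        exact (mp (mp (Hclosed u v) Hu) (bwd (Hf' u v) (hor_introl R))).
      * rewrite_eq h. assumption.
Qed.

(** * The counting axiom *)

(** Used for both coordinates of the relation [W] below: once with the successor iterated from zero,
    once with the orbit function iterated from [c]. *)
Lemma iterate_step {G} j j' f a x x' t : (G ⊩ preserves_functional j) ->
  (G ⊩ is_succ_of j j') -> (G ⊩ functional f) ->
  (G ⊩ rel j f t) -> (G ⊩ rel t a x) -> (G ⊩ rel f x x') ->
  G ⊩ ∃ t', rel j' f t' ∧ rel t' a x'.
Proof.
  intros Hj Hj' Hf Kt Ka R.
  elim_cases (next_iterate_ex j f) as [t' Ht'].
  refine (hex_intro t' (hand_intro (bwd (rel_succ_of _ _ _ _ Hj') (hand_intro Hf Ht'))
    (bwd (rel_next_iterate _ _ _ _ _ Ht') (hex_intro t (hex_intro x _))))).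
  exact (hand_intro (mp (mp (Hj f t) Hf) Kt) (hand_intro Kt (hand_intro Ka R))).
Qed.

Lemma iterate_zero {G} z f a : (G ⊩ is_zero z) -> G ⊩ ∃ t, rel z f t ∧ rel t a a.
Proof.
  intros Hz. elim_cases id_ex as [i Hi].
  exact (hex_intro i (hand_intro (bwd (rel_zero _ _ _ Hz) Hi)
    (bwd (rel_id _ _ _ Hi) (heq_refl a)))).
Qed.

(** The counting axiom speaks of [Ap]. Since [j] and its iterate [s] of [S] are functional, the two
    applications have the related values [s] and [n]. *)
Lemma counting_eq {G} N S z j s n : (G ⊩ counting) -> (G ⊩ is_NN N) ->
  (G ⊩ is_succ S) -> (G ⊩ is_zero z) -> (G ⊩ j ∈ N) ->
  (G ⊩ rel j S s) -> (G ⊩ rel s z n) -> G ⊩ n ≐ j.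
Proof.
  intros HC HN HS Hz Hj Ks Kn.
  elim_cases (mp (HC j) (hex_intro N (hand_intro HN Hj)))
    as (S' & HS' & g & Hg & z' & Hz' & a & Ha & E).
  destruct (NN_numeral _ _ HN Hj) as [[Hf Hpf] _].
  pose proof (sets_eq _ _ _ HS' HS) as ES. rewrite_eq ES.
  pose proof (sets_eq _ _ _ Hz' Hz) as Ez. rewrite_eq Ez.
  pose proof (app_eq _ _ _ _ Hf Ks Hg) as Eg. rewrite_eq Eg.
  pose proof (mp (mp (Hpf S s) (functional_succ _ HS)) Ks) as Hs.
  pose proof (app_eq _ _ _ _ Hs Kn Ha) as Ea.
  exact (heq_trans _ _ _ (heq_sym _ _ Ea) E).
Qed.

Lemma NN_not_finite {G} N :
  (G ⊩ counting) -> (G ⊩ is_NN N) -> (G ⊩ finite N) -> G ⊩ hbot.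
Proof.
  intros HC HN Hfin.
  comprehend (fun _ : D => hbot) as c Hempty.
  claim Hc : (¬ c ∈ N).
  { assume h. destruct (NN_numeral _ _ HN h) as [_ K]. elim_cases K as [u Hu].
    exact (fwd (Hempty u) Hu). }
  elim_cases (finite_orbit N c Hfin Hc) as (f & Hf & orbit).
  elim_cases zero_ex as [z Hz]. elim_cases succ_ex as [S HS].
  comprehend_rel (fun n y => ∃ j, j ∈ N ∧
    (∃ s, rel j S s ∧ rel s z n) ∧ (∃ r, rel j f r ∧ rel r c y)) as W HW.
  (* By counting, the witness [j] is [n] itself. *)
  claim HWn : (∀ n y, rel W n y ⟶ n ∈ N ∧ ∃ r, rel n f r ∧ rel r c y).
  { intros n y. assume h.
    elim_cases (fwd (HW n y) h) as (j & Hj & (s & Ks & Kn) & (r & Kr & Ky)).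
    pose proof (heq_sym _ _ (counting_eq _ _ _ _ _ _ HC HN HS Hz Hj Ks Kn)) as E.
    rewrite_eq E. exact (hand_intro Hj (hex_intro r (hand_intro Kr Ky))). }
  refine (mp (mp (pigeonhole N c Hfin Hc W) _) _).
  - intros n y y'. assume h. assume h'.
    destruct (mp (HWn n y) h) as [Hn C1]. destruct (mp (HWn n y') h') as [_ C2].
    elim_cases C1 as (r & Kr & Ky). elim_cases C2 as (r' & Kr' & Ky').
    destruct (NN_numeral _ _ HN Hn) as [[Hnf Hpf] _].
    pose proof (mp (mp (Hpf f r') Hf) Kr') as Hr.
    pose proof (functionalE _ _ _ _ Hnf Kr Kr') as E. rewrite_eq E.
    exact (functionalE _ _ _ _ Hr Ky Ky').
  (* The range of [W] contains [c] and is closed under [f], so it contains the whole orbit. *)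
  - comprehend (fun y => ∃ n, rel W n y) as o Ho.
    intros y. assume Hy. assume K.
    claim Hyo : (y ∈ o).
    { refine (mp (mp (mp (orbit o) _) _ y) Hy).
      (* Zero iterations of [S] on zero give zero, and zero iterations of [f] on [c] give [c]. *)
      - apply (bwd (Ho c)), (hex_intro z), (bwd (HW z c)), (hex_intro z).
        exact (hand_intro (zero_in_NN _ _ HN Hz)
          (hand_intro (iterate_zero _ _ _ Hz) (iterate_zero _ _ _ Hz))).
      - intros u v. assume Hu. assume R.
        elim_cases (fwd (Ho u) Hu) as [n Kn].
        destruct (mp (HWn n u) Kn) as [Hn _].
        elim_cases (fwd (HW n u) Kn) as (j & Hj & (s & Ks & Kz) & (r & Kr & Kc)).
        (* The pair of [n'] and [v] is in [W] with witness [j'], the successor of [j]: one more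
           iteration takes [n] to [n'] under [S] and [u] to [v] under [f]. *)
        elim_cases (succ_of_ex n) as [n' Hn'].
        apply (bwd (Ho v)), (hex_intro n').
        destruct (NN_numeral _ _ HN Hn) as [[Hnf _] _].
        destruct (NN_numeral _ _ HN Hj) as [[_ Hjp] _].
        elim_cases (succ_of_ex j) as [j' Hj'].
        apply (bwd (HW n' v)), (hex_intro j').
        refine (hand_intro (succ_of_in_NN _ _ _ HN Hj Hj') (hand_intro _ _)).
        + exact (iterate_step _ _ _ _ _ _ _ Hjp Hj' (functional_succ _ HS) Ks Kz
            (bwd (rel_succ _ _ _ HS) (hand_intro Hnf Hn'))).
        + exact (iterate_step _ _ _ _ _ _ _ Hjp Hj' Hf Kr Kc R). }
    elim_cases (fwd (Ho y) Hyo) as [n Kn].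
    exact (mp K (hex_intro n (hand_intro (proj1 (mp (HWn n y) Kn)) Kn))).
Qed.

Close Scope truth_scope.
Open Scope inf_scope.

Theorem theorem18p6 :
  proves INF (sentence (church_counting ⟶ ¬ NN ∈ FINITE)).
Proof.
  (* Provability becomes truth under the assignment that interprets each variable as itself. *)
  rewrite <- (ren_id (sentence _) (fun n => n)) by reflexivity.
  apply tr_prv. rewrite tr_theorem.
  assume HC. assume h. elim_cases h as (N & HN & F & HF & HNF).
  exact (NN_not_finite N HC HN (fwd (HF N) HNF)).
Qed.
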